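(* Let $n,k,d$ be positive integers. The maps $\Phi$ and $\Psi$ (which are mutually inverse bijections between equivalence classes of nondegenerate $[n,k,d]_{q^m/q}$ codes and equivalence classes of $[n,k,d]_{q^m/q}$ systems) restrict to a 1-to-1 correspondence between the equivalence classes of nondegenerate minimal $[n,k,d]_{q^m/q}$ rank-metric codes and the equivalence classes of $[n,k,d]_{q^m/q}$ systems that are linear cutting blocking sets.
   Context: Let $q$ be a prime power and $m$ a positive integer. For $v\in\mathbb{F}_{q^m}^n$ and an ordered basis $\Gamma=(\gamma_1,\dots,\gamma_m)$ of $\mathbb{F}_{q^m}$ over $\mathbb{F}_q$, let $\Gamma(v)\in\mathbb{F}_q^{n\times m}$ be the matrix with $v_i=\sum_{j}\Gamma(v)_{ij}\gamma_j$. The rank support $\sigma^{\mathrm{rk}}(v)\subseteq\mathbb{F}_q^n$ is the column space of $\Gamma(v)$ (independent of $\Gamma$), and $\mathrm{rk}(v)=\dim_{\mathbb{F}_q}\sigma^{\mathrm{rk}}(v)$. An $[n,k,d]_{q^m/q}$ code is a $k$-dimensional $\mathbb{F}_{q^m}$-subspace $\mathcal{C}\subseteq\mathbb{F}_{q^m}^n$ whose nonzero codewords have minimum rank $d$. It is nondegenerate if $\sum_{v\in\mathcal{C}}\sigma^{\mathrm{rk}}(v)=\mathbb{F}_q^n$. Two codes $\mathcal{C},\mathcal{C}'\subseteq\mathbb{F}_{q^m}^n$ are equivalent if $\mathcal{C}'=\{vA:v\in\mathcal{C}\}$ for some $A\in\mathrm{GL}_n(q)$. A code $\mathcal{C}$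 is minimal if for all $v,v'\in\mathcal{C}$, $\sigma^{\mathrm{rk}}(v')\subseteq\sigma^{\mathrm{rk}}(v)$ implies $v'=\alpha v$ for some $\alpha\in\mathbb{F}_{q^m}$. An $[n,k,d]_{q^m/q}$ system is an $n$-dimensional $\mathbb{F}_q$-subspace $\mathcal{U}\subseteq\mathbb{F}_{q^m}^k$ with $\langle\mathcal{U}\rangle_{\mathbb{F}_{q^m}}=\mathbb{F}_{q^m}^k$ and $d=n-\max\{\dim_{\mathbb{F}_q}(\mathcal{U}\cap H): H \text{ an } \mathbb{F}_{q^m}\text{-hyperplane of } \mathbb{F}_{q^m}^k\}$. Two systems are equivalent if an $\mathbb{F}_{q^m}$-linear automorphism of $\mathbb{F}_{q^m}^k$ maps one to the other. A system $\mathcal{U}$ is a linear cutting blocking set if for all $\mathbb{F}_{q^m}$-hyperplanes $H,H'\subseteq\mathbb{F}_{q^m}^k$, $(\mathcal{U}\cap H)\subseteq(\mathcal{U}\cap H')$ implies $H=H'$. $\Phi$ sends the class of a nondegenerate code $\mathcal{C}$ to the class of the $\mathbb{F}_q$-span in $\mathbb{F}_{q^m}^k$ of the columns of a generator matrix $G\in\mathbb{F}_{q^m}^{k\times n}$ of $\mathcal{C}$. $\Psi$ sends the class of a system $\mathcal{U}$ to the class of the code generated by the rows of the $k\times n$ matrix whose columns form an $\mathbb{F}_q$-basis of $\mathcal{U}$. *)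

(* Defs.v *)
From HB Require Import structures.
From mathcomp Require Import all_boot all_order all_algebra all_field.
From mathcomp Require Import boolp classical_sets functions.

Set Implicit Arguments.
Unset Strict Implicit.
Unset Printing Implicit Defensive.

Import GRing.Theory.

Local Open Scope ring_scope.
Local Open Scope classical_set_scope.

(* Restriction of scalars: [restr V] is the carrier of the L-space V, seen as
   an F-vector space. As for [baseFieldType], the two types are convertible but
   carry different scalings, related by [restr_scaleE]. *)
Definition restr (F : fieldType) (L : fieldExtType F) (V : vectType L) : Type :=
  V.

Section Restr.
Variables (F : fieldType) (L : fieldExtType F) (V : vectType L).
Local Notation V0 := (restr V).

HB.instance Definition _ := GRing.Zmodule.copy V0 V.

Definition restr_scale (a : F) (u : V0) : V0 := (a%:A : L) *: (u : V).

Fact restr_scaleA a b u : restr_scale a (restr_scale b u) = restr_scale (a * b) u.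
Proof. by rewrite /restr_scale scalerA -[a%:A]/(in_alg L a) -rmorphM. Qed.

Fact restr_scale1 : left_id 1 restr_scale.
Proof. by move=> u; rewrite /restr_scale !scale1r. Qed.

Fact restr_scaleDr : right_distributive restr_scale +%R.
Proof. by move=> a u v; apply: scalerDr. Qed.

Fact restr_scaleDl v : {morph restr_scale^~ v : a b / a + b}.
Proof. by move=> a b; rewrite /restr_scale !scalerDl. Qed.

HB.instance Definition _ := GRing.Zmodule_isLmodule.Build F V0
  restr_scaleA restr_scale1 restr_scaleDr restr_scaleDl.

Lemma restr_scaleE a (u : V) : a *: (u : V0) = a%:A *: u.
Proof. by []. Qed.

Let m := \dim {:L}.
Let bL : m.-tuple L := vbasis {:L}.

Let restr_scaleZ (a : F) (x : L) (v : V) :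
  a *: ((x *: v : V) : V0) = (a *: x) *: v.
Proof. by rewrite [LHS]scalerA -scalerAl mul1r. Qed.

Fact restr_vect_iso : Lmodule_hasFinDim F V0.
Proof.
pose bV := vbasis {:V}; set n := \dim {:V} in bV.
pose v2r (x : V0) := mxvec (\matrix_(i, j) coord bL j (coord bV i (x : V))).
have v2r_lin : linear v2r.
  move=> a x y; rewrite -linearP; congr mxvec; apply/matrixP=> i j.
  by rewrite !mxE linearP /= mulr_algl linearP.
pose r2v r : V0 := \sum_(i < n) (\sum_(j < m) vec_mx r i j *: bL`_j) *: bV`_i.
have v2rK : cancel v2r r2v.
  move=> x; transitivity (\sum_(i < n) coord bV i (x : V) *: bV`_i); last first.
    by symmetry; apply: (coord_vbasis (memvf (x : V))).
  apply: eq_bigr => i _; rewrite mxvecK; congr (_ *: _ : V).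
  rewrite [RHS](coord_vbasis (memvf (coord bV i (x : V)))).
  by apply: eq_bigr => j _; rewrite mxE.
have r2vK : cancel r2v v2r.
  move=> r; apply: (canLR vec_mxK); apply/matrixP=> i j; rewrite mxE.
  by rewrite !coord_sum_free ?(basis_free (vbasisP _)).
by exists (n * m)%N; exists v2r => //; exists r2v.
Qed.
HB.instance Definition _ := restr_vect_iso.

(* The L-subspace H seen as an F-subspace; see [mem_restrv]. *)
Definition restrv (H : {vspace V}) : {vspace V0} :=
  <<[seq ((bL`_ij.2 *: (vbasis H)`_ij.1 : V) : V0) |
      ij : 'I_(\dim H) * 'I_m]>>%VS.

Lemma mem_restrv (H : {vspace V}) (v : V) : ((v : V0) \in restrv H) = (v \in H).
Proof.
apply/idP/idP=> [vH|/coord_vbasis->]; last first.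
  apply: (@memv_suml F V0) => i _.
  rewrite (coord_vbasis (memvf (coord (vbasis H) i v))) scaler_suml.
  apply: (@memv_suml F V0) => j _.
  rewrite -restr_scaleZ; apply: memvZ; apply: memv_span.
  by apply/fintype.imageP; exists (i, j).
rewrite (coord_span vH).
apply: (@memv_suml L V) => i _; rewrite restr_scaleE memvZ //.
set s := (X in X`_i); have : s`_i \in s by rewrite mem_nth ?size_tuple.
move=> /fintype.imageP[[j1 j2] _ ->].
by rewrite memvZ // vbasis_mem // mem_nth ?size_tuple.
Qed.

End Restr.

Section LSpan.
Variables (F : finFieldType) (L : fieldExtType F) (V : vectType L).

Definition Lspan (U : {vspace restr V}) : {vspace V} :=
  <<[seq (u : V) | u : finvect_type (restr V) in U]>>%VS.

End LSpan.

Section Codes.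
Variables (F : finFieldType) (L : fieldExtType F) (n : nat).
Implicit Types (v : 'rV[L]_n) (C : {vspace 'rV[L]_n}).

(* The matrix Gamma(v), where Gamma is a basis of L over F. *)
Definition expand m (Gamma : m.-tuple L) v : 'M[F]_(n, m) :=
  \matrix_(i, j) coord Gamma j (v 0 i).

Definition colspace m (M : 'M[F]_(n, m)) : {vspace 'cV[F]_n} :=
  <<[seq col j M | j : 'I_m]>>%VS.

(* The choice of basis is immaterial; see [rank_supportE]. *)
Definition rank_support v : {vspace 'cV[F]_n} :=
  colspace (expand (vbasis {:L}) v).

Lemma expandP m (Gamma : m.-tuple L) v i : basis_of {:L} Gamma ->
  v 0 i = \sum_j expand Gamma v i j *: Gamma`_j.
Proof.
move=> Gb; rewrite [LHS](coord_basis Gb (memvf _)).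
by apply: eq_bigr => j _; rewrite mxE.
Qed.

Lemma colspace_expand_sub m1 m2 (G1 : m1.-tuple L) (G2 : m2.-tuple L) v :
  basis_of {:L} G1 ->
  (colspace (expand G2 v) <= colspace (expand G1 v))%VS.
Proof.
move=> b1; apply/span_subvP=> _ /fintype.imageP[j _ ->].
have -> : col j (expand G2 v) =
    \sum_(l < m1) coord G2 j G1`_l *: col l (expand G1 v).
  apply/colP=> i; rewrite summxE !mxE (expandP v i b1) linear_sum.
  by apply: eq_bigr => l _; rewrite linearZ !mxE mulrC.
apply: memv_suml => l _; apply: memvZ; apply: memv_span.
by apply/fintype.imageP; exists l.
Qed.

Lemma rank_supportE m (Gamma : m.-tuple L) v : basis_of {:L} Gamma ->
  rank_support v = colspace (expand Gamma v).
Proof.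
move=> Gb; apply/eqP; rewrite eqEsubv.
by rewrite !colspace_expand_sub // vbasisP.
Qed.

Definition rk v : nat := \dim (rank_support v).

Definition is_code (k d : nat) C : Prop :=
  [/\ \dim C = k,
      exists v, [/\ v \in C, v != 0 & rk v = d]
    & forall v, v \in C -> v != 0 -> (d <= rk v)%N].

(* [finvect_type (restr _)] only serves to make the index type a finType. *)
Definition nondegenerate_code C : Prop :=
  (\sum_(v : finvect_type (restr 'rV[L]_n) | (v : 'rV[L]_n) \in C)
     rank_support v)%VS = fullv.

Definition code_equiv C C' : Prop :=
  exists2 A : 'M[F]_n, A \in unitmx &
    C' = (linfun (mulmxr (map_mx (in_alg L) A)) @: C)%VS.

Definition minimal_code C : Prop :=
  forall v v', v \in C -> v' \in C ->
    (rank_support v' <= rank_support v)%VS -> exists alpha : L, v' = alpha *: v.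

Definition code_class C : set {vspace 'rV[L]_n} := [set C' | code_equiv C C'].

End Codes.

Section Systems.
Variables (F : finFieldType) (L : fieldExtType F) (k : nat).
Implicit Types (U : {vspace restr 'cV[L]_k}) (H : {vspace 'cV[L]_k}).

Definition hyperplane H : Prop := (\dim H).+1 = k.

Definition max_section U (t : nat) : Prop :=
  (exists2 H, hyperplane H & \dim (U :&: restrv H)%VS = t) /\
  (forall H, hyperplane H -> (\dim (U :&: restrv H)%VS <= t)%N).

Definition is_system (n d : nat) U : Prop :=
  [/\ \dim U = n,
      Lspan U = fullv
    & exists2 t, max_section U t & d = (n - t)%N].

Definition system_equiv U U' : Prop :=
  exists2 f : 'End('cV[L]_k), bijective f & f @` [set` U] = [set` U'].

Definition cutting U : Prop :=
  forall H H', hyperplane H -> hyperplane H' ->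
    (U :&: restrv H <= U :&: restrv H')%VS -> H = H'.

Definition system_class U : set {vspace restr 'cV[L]_k} :=
  [set U' | system_equiv U U'].

End Systems.

Section Correspondence.
Variables (F : finFieldType) (L : fieldExtType F) (n k : nat).

Definition columns (G : 'M[L]_(k, n)) : seq (restr 'cV[L]_k) :=
  [seq (col j G : restr 'cV[L]_k) | j : 'I_n].

Definition rows (G : 'M[L]_(k, n)) : seq 'rV[L]_n := [seq row i G | i : 'I_k].

Definition generator_matrix (C : {vspace 'rV[L]_n}) (G : 'M[L]_(k, n)) : Prop :=
  basis_of C (rows G).

(* Phi and Psi act on classes, with the union taken over all representatives
   and all matrices: the value is a single class exactly when the construction
   does not depend on these choices. *)
Definition Phi (X : set {vspace 'rV[L]_n}) : set {vspace restr 'cV[L]_k} :=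
  [set U | exists C G, [/\ X C, generator_matrix C G
                         & system_class <<columns G>>%VS U]].

Definition Psi (Y : set {vspace restr 'cV[L]_k}) : set {vspace 'rV[L]_n} :=
  [set C | exists U G, [/\ Y U, basis_of U (columns G)
                         & code_class <<rows G>>%VS C]].

End Correspondence.

Arguments Phi {F} L n k X.
Arguments Psi {F} L n k Y.

Section Classes.
Variables (F : finFieldType) (L : fieldExtType F) (n k d : nat).

Definition nondeg_classes : set (set {vspace 'rV[L]_n}) :=
  [set code_class C | C in [set C | is_code k d C /\ nondegenerate_code C]].

Definition nondeg_minimal_classes : set (set {vspace 'rV[L]_n}) :=
  [set code_class C |
    C in [set C | [/\ is_code k d C, nondegenerate_code C & minimal_code C]]].

Definition system_classes : set (set {vspace restr 'cV[L]_k}) :=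
  [set system_class U | U in [set U | is_system n d U]].

Definition cutting_classes : set (set {vspace restr 'cV[L]_k}) :=
  [set system_class U | U in [set U | is_system n d U /\ cutting U]].

End Classes.

Arguments nondeg_classes {F} L n k d.
Arguments nondeg_minimal_classes {F} L n k d.
Arguments system_classes {F} L n k d.
Arguments cutting_classes {F} L n k d.

Definition inverse_bijections (S T : Type) (A : set S) (B : set T)
    (f : S -> T) (g : T -> S) : Prop :=
  [/\ set_bij A B f, set_bij B A g, {in A, cancel f g} & {in B, cancel g f}].

(* Main.v *)
(** Both sides are double classes GL_k(q^m) \ M / GL_n(q) of k x n matrices G
    with independent rows over F_{q^m} and independent columns over F_q: the
    code is the row space of G, the system U the F_q-span of its columns.
    For x <> 0 let H_x be the hyperplane {u | x u = 0}.  A vector a of F_q^n is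
    orthogonal to the rank support of xG iff x(Ga) = 0, i.e. iff the point Ga
    of U lies in H_x.  Hence dim (U :&: H_x) = n - rk(xG), which matches the two
    notions of d, and U :&: H_x is contained in U :&: H_x' iff the support of
    x'G is contained in that of xG.  As H_x = H_x' iff x and x' are
    proportional, the code is minimal iff U is cutting. *)
From HB Require Import structures.
Require Import Defs.
From mathcomp Require Import all_boot all_order all_algebra all_field.
From mathcomp Require Import boolp classical_sets functions.

Set Implicit Arguments.
Unset Strict Implicit.
Unset Printing Implicit Defensive.

Import GRing.Theory.

Local Open Scope ring_scope.

(** * Spans and freeness of families indexed by ordinals *)

Section SpanImage.
Variables (K : fieldType) (V : vectType K) (m : nat) (f : 'I_m -> V).

(** Coefficients form a plain function on the indices, the common form needed for [colspace], [rows]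
    and [columns]. *)
Lemma span_imageP w :
  reflect (exists c : 'I_m -> K, w = \sum_i c i *: f i)
          (w \in <<[seq f i | i : 'I_m]>>%VS).
Proof.
have fE (i : 'I_m) : (mktuple f)`_i = f i by rewrite -tnth_nth tnth_mktuple.
apply: (iffP idP) => [|[c ->]].
  move=> /(@coord_span _ _ _ (mktuple f)) ->; exists (coord (mktuple f) ^~ w).
  by apply: eq_bigr => i _; rewrite fE.
by apply: memv_suml => i _; apply/memvZ/memv_span/fintype.imageP; exists i.
Qed.

Lemma free_imageP :
  free [seq f i | i : 'I_m] <->
  (forall c : 'I_m -> K, \sum_i c i *: f i = 0 -> forall i, c i = 0).
Proof.
have fE (i : 'I_m) : (mktuple f)`_i = f i by rewrite -tnth_nth tnth_mktuple.
split=> [/(@freeP _ _ _ (mktuple f)) fr c cf|fr].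
  by apply: fr; rewrite -[RHS]cf; apply: eq_bigr => i _; rewrite fE.
apply/(@freeP _ _ _ (mktuple f)) => c cf.
by apply: fr; rewrite -[RHS]cf; apply: eq_bigr => i _; rewrite fE.
Qed.

End SpanImage.

(** * Annihilators and kernels of matrices *)

Section Annihilators.
Variable K : fieldType.

Lemma row_free_kerP (p q : nat) (A : 'M[K]_(p, q)) :
  row_free A <-> (forall x : 'rV_p, x *m A = 0 -> x = 0).
Proof.
split=> [Afree x xA|]; last exact: inj_row_free.
by apply: (row_free_inj Afree); rewrite xA mul0mx.
Qed.

Lemma unitmx_kerP p (A : 'M[K]_p) :
  A \in unitmx <-> (forall u : 'cV_p, A *m u = 0 -> u = 0).
Proof.
rewrite -unitmx_tr -row_free_unit row_free_kerP.
split=> H u /(congr1 trmx); rewrite trmx_mul trmx0.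
  by move/H => u0; apply: trmx_inj; rewrite trmx0.
by rewrite trmxK => /H u0; apply: trmx_inj; rewrite trmx0.
Qed.

(** The columns of [cokermx B] are killed by [B], and [A <= B] amounts to [A *m cokermx B = 0], so
    testing these columns suffices. *)
Lemma submx_annihilatorP (p1 p2 q : nat) (A : 'M[K]_(p1, q)) (B : 'M_(p2, q)) :
  (A <= B)%MS <-> (forall u : 'cV_q, B *m u = 0 -> A *m u = 0).
Proof.
split=> [/submxP[D ->] u Bu|AB]; first by rewrite -mulmxA Bu mulmx0.
rewrite submxE; apply/eqP/matrixP => i j.
have /AB/colP/(_ i) : B *m col j (cokermx B) = 0.
  by rewrite colE mulmxA mulmx_coker mul0mx.
by rewrite colE mulmxA -colE !mxE.
Qed.

(** A matrix whose columns form a basis of [W] has rank below [p], so its rows are dependent; [x] is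
    such a dependence. *)
Lemma proper_subspace_annihilator (p : nat) (W : {vspace 'cV[K]_p}) :
  W != fullv ->
  exists2 x : 'rV_p, x != 0 & forall w, w \in W -> x *m w = 0.
Proof.
move=> Wn.
pose M : 'M[K]_(p, \dim W) := \matrix_(i, j) (vbasis W)`_j i 0.
have colM j : col j M = (vbasis W)`_j by apply/colP=> i; rewrite !mxE.
have: ~~ row_free M.
  apply: contra Wn => /eqP Mr; rewrite eqEdim subvf dimvf /dim /= muln1.
  by rewrite -{1}Mr rank_leq_col.
rewrite -kermx_eq0 => /rowV0Pn[x /sub_kermxP xM x0]; exists x => // w.
move=> /coord_vbasis ->; rewrite mulmx_sumr big1 // => i _.
by rewrite -scalemxAr -colM colE mulmxA xM mul0mx scaler0.
Qed.

(** For a nonzero row [x] over L this is the hyperplane H_x; for the transposed expansion of [v] it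
    is the orthogonal of the rank support of [v]. *)
Definition mulmx_lker p q (A : 'M[K]_(p, q)) : {vspace 'cV[K]_q} :=
  lker (linfun (mulmx A : 'cV[K]_q -> 'cV[K]_p)).

Lemma mem_mulmx_lker p q (A : 'M[K]_(p, q)) (u : 'cV_q) :
  (u \in mulmx_lker A) = (A *m u == 0).
Proof. by rewrite memv_ker lfunE. Qed.

(** In [A = col_base A *m row_base A] the right factor has a right inverse, so the image is that of
    [col_base A], which is injective on a space of dimension [\rank A]. *)
Lemma dim_limg_mulmx p q (A : 'M[K]_(p, q)) :
  \dim (limg (linfun (mulmx A : 'cV[K]_q -> 'cV[K]_p))) = \rank A.
Proof.
set r := \rank A.
pose f1 : 'Hom('cV[K]_r, 'cV[K]_p) := linfun (mulmx (col_base A)).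
have -> : limg (linfun (mulmx A : 'cV[K]_q -> 'cV[K]_p)) = limg f1.
  apply/vspaceP => w; apply/memv_imgP/memv_imgP=> -[u _ ->]; rewrite lfunE /=.
    by exists (row_base A *m u); rewrite ?memvf // lfunE /= mulmxA mulmx_base.
  have /row_freeP[B RB] := row_base_free A.
  exists (B *m u); rewrite ?memvf // lfunE /=.
  transitivity (col_base A *m row_base A *m (B *m u)).
    by rewrite -mulmxA (mulmxA (row_base A)) RB mul1mx.
  by rewrite mulmx_base.
rewrite limg_dim_eq ?dimvf /dim /= ?muln1 //.
apply/eqP; rewrite -subv0; apply/subvP => u; rewrite memv_cap memvf /=.
rewrite memv_ker lfunE /= memv0 => /eqP Cu.
have /row_fullP[B BC] := col_base_full A.
by rewrite -[u]mul1mx -BC -mulmxA Cu mulmx0.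
Qed.

Lemma dim_mulmx_lker p q (A : 'M[K]_(p, q)) :
  (\dim (mulmx_lker A) + \rank A)%N = q.
Proof.
have := limg_ker_dim (linfun (mulmx A : 'cV[K]_q -> 'cV[K]_p)) fullv.
by rewrite capfv dim_limg_mulmx dimvf /dim /= muln1.
Qed.

End Annihilators.
Local Open Scope classical_set_scope.

(** * Rank supports and their orthogonals *)

Section RankSupport.
Variables (F : finFieldType) (L : fieldExtType F) (n : nat).
Implicit Types (v : 'rV[L]_n) (a : 'cV[F]_n).
Local Notation inL := (map_mx (in_alg L)).

Lemma mem_colspace m (M : 'M[F]_(n, m)) w :
  w \in colspace M <-> exists c : 'cV_m, w = M *m c.
Proof.
split=> [/span_imageP[c ->]|[c ->]]; last first.
  apply/span_imageP; exists (fun j => c j 0).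
  apply/colP=> i; rewrite summxE mxE; apply: eq_bigr => j _.
  by rewrite !mxE mulrC.
exists (\col_j c j); apply/colP=> i; rewrite summxE mxE; apply: eq_bigr => j _.
by rewrite !mxE mulrC.
Qed.

Lemma colspace_sub m1 m2 (M1 : 'M[F]_(n, m1)) (M2 : 'M[F]_(n, m2)) :
  (colspace M1 <= colspace M2)%VS = (M1^T <= M2^T)%MS.
Proof.
apply/idP/idP=> [/subvP M12 | /submxP[D M12]].
  apply/row_subP => i; rewrite -tr_col.
  have /M12/mem_colspace[c ->] : col i M1 \in colspace M1.
    by apply/mem_colspace; exists (delta_mx i 0); rewrite colE.
  by rewrite trmx_mul submxMl.
apply/subvP => _ /mem_colspace[c ->]; apply/mem_colspace; exists (D^T *m c).
by rewrite mulmxA -[M1]trmxK M12 trmx_mul trmxK.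
Qed.

Lemma dim_colspace m (M : 'M[F]_(n, m)) : \dim (colspace M) = \rank M.
Proof.
rewrite -dim_limg_mulmx; congr (\dim _); apply/vspaceP => w.
apply/idP/memv_imgP => [/mem_colspace[c ->]|[c _ ->]].
  by exists c; rewrite ?memvf // lfunE.
by apply/mem_colspace; exists c; rewrite lfunE.
Qed.

(** The product of [v] and [a] is a scalar of L whose coordinates in the free family [vbasis {:L}]
    are the entries of the left-hand vector. *)
Lemma expand_annihilator v a :
  (expand (vbasis {:L}) v)^T *m a = 0 <-> v *m inL a = 0.
Proof.
set E := expand _ v.
have vaE : v *m inL a = (\sum_j (E^T *m a) j 0 *: (vbasis {:L})`_j)%:M.
  apply/matrixP => i j; rewrite !ord1 !mxE mulr1n.
  under eq_bigr => l _ do rewrite mxE (expandP v l (vbasisP _)) mulr_suml.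
  rewrite exchange_big; apply: eq_bigr => l _ /=.
  rewrite mxE scaler_suml; apply: eq_bigr => p _.
  by rewrite !mxE mulr_algr scalerA mulrC.
rewrite vaE; split=> [->|Ea].
  by rewrite big1 ?rmorph0 // => j _; rewrite mxE scale0r.
apply/colP=> j; rewrite [RHS]mxE; move: j.
have /freeP := basis_free (vbasisP {:L}); apply.
by have /matrixP/(_ 0 0) := Ea; rewrite !mxE.
Qed.

Lemma rank_support_subP v v' :
  (rank_support v' <= rank_support v)%VS <->
  (forall a, v *m inL a = 0 -> v' *m inL a = 0).
Proof.
rewrite colspace_sub submx_annihilatorP.
by split=> H a /expand_annihilator/H/expand_annihilator.
Qed.

(** Row form of the criterion, matching the functionals produced by
    [proper_subspace_annihilator]. *)
Lemma rank_support_orthogonal v (x : 'rV[F]_n) :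
  (forall w, w \in rank_support v -> x *m w = 0) <-> v *m inL x^T = 0.
Proof.
rewrite -expand_annihilator -trmx_mul; set E := expand _ v.
split=> [xv|/(congr1 trmx)]; last first.
  by rewrite trmxK trmx0 => xE w /mem_colspace[c ->]; rewrite mulmxA xE mul0mx.
apply/trmx_inj; rewrite trmxK trmx0; apply/rowP=> j.
have /xv/colP/(_ 0) : col j E \in rank_support v.
  by apply/mem_colspace; exists (delta_mx j 0); rewrite colE.
by rewrite colE mulmxA -colE !mxE.
Qed.

Lemma rank_row_annihilator v :
  (\dim (mulmx_lker (expand (vbasis {:L}) v)^T) + rk v)%N = n.
Proof. by rewrite /rk dim_colspace -mxrank_tr dim_mulmx_lker. Qed.

End RankSupport.

(** * The code and the system attached to one matrix *)

Section GeneratorMatrix.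
Variables (F : finFieldType) (L : fieldExtType F) (n k : nat).
Implicit Types (G : 'M[L]_(k, n)) (x : 'rV[L]_k) (a : 'cV[F]_n).
Local Notation inL := (map_mx (in_alg L)).

Lemma mem_rows G v : v \in <<rows G>>%VS <-> exists x, v = x *m G.
Proof.
split=> [/span_imageP[c ->]|[x ->]]; last first.
  by apply/span_imageP; exists (fun i => x 0 i); rewrite mulmx_sum_row.
exists (\row_i c i); rewrite mulmx_sum_row; apply: eq_bigr => i _.
by rewrite mxE.
Qed.

Lemma free_rows G : free (rows G) <-> row_free G.
Proof.
rewrite row_free_kerP free_imageP; split=> [fr x xG|fr c cG i].
  apply/rowP => i; rewrite mxE; move: i; apply: fr.
  by rewrite -mulmx_sum_row.
have /rowP/(_ i) : \row_i c i = 0.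
  apply: fr; rewrite mulmx_sum_row -[RHS]cG; apply: eq_bigr => j _.
  by rewrite mxE.
by rewrite !mxE.
Qed.

(** Typed in [restr] so that the map is linear over F; its image is the system spanned by the
    columns. *)
Definition columns_comb G a : restr 'cV[L]_k := G *m inL a.

Fact columns_comb_linear G : linear (columns_comb G).
Proof.
move=> c a b; rewrite /columns_comb map_mxD map_mxZ mulmxDr -scalemxAr.
by rewrite restr_scaleE.
Qed.

HB.instance Definition _ G :=
  GRing.isLinear.Build F 'cV[F]_n (restr 'cV[L]_k) _ (columns_comb G)
    (columns_comb_linear G).

Lemma columns_combE G a :
  columns_comb G a = \sum_j a j 0 *: (col j G : restr 'cV[L]_k).
Proof.
rewrite [in LHS](matrix_sum_delta a) linear_sum; apply: eq_bigr => j _.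
rewrite big_ord1 [LHS]linearZ; congr (_ *: _).
by rewrite /= /columns_comb map_delta_mx -colE.
Qed.

Lemma mem_columns G u : u \in <<columns G>>%VS <-> exists a, u = columns_comb G a.
Proof.
split=> [/span_imageP[c ->]|[a ->]]; last first.
  by apply/span_imageP; exists (fun j => a j 0); rewrite columns_combE.
exists (\col_j c j); rewrite columns_combE; apply: eq_bigr => j _.
by rewrite mxE.
Qed.

Definition col_free G : Prop := forall a, G *m inL a = 0 -> a = 0.

Lemma free_columns G : free (columns G) <-> col_free G.
Proof.
rewrite free_imageP; split=> [fr a aG|fr c cG j].
  apply/colP => j; rewrite mxE; move: j; apply: fr.
  by rewrite -columns_combE.
have /colP/(_ j) : \col_j c j = 0.
  apply: fr; transitivity (columns_comb G (\col_j c j)) => //.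
  rewrite columns_combE -[RHS]cG; apply: eq_bigr => i _.
  by rewrite mxE.
by rewrite !mxE.
Qed.

(** The map [columns_comb G] is injective and sends the annihilator of xG in F^n onto the section;
    rank-nullity for the expansion of xG then gives the count. *)
Lemma dim_section G x : col_free G ->
  (\dim (<<columns G>> :&: restrv (mulmx_lker x)) + rk (x *m G))%N = n.
Proof.
move=> Gf; rewrite -[RHS](rank_row_annihilator (x *m G)); congr (_ + _)%N.
set K := mulmx_lker (expand _ _)^T.
have -> : (<<columns G>> :&: restrv (mulmx_lker x) =
           linfun (columns_comb G) @: K)%VS.
  apply/vspaceP => u; rewrite memv_cap mem_restrv mem_mulmx_lker.
  apply/andP/memv_imgP => [[/mem_columns[a ->] /eqP xu]|[a aK ->]].
    exists a; last by rewrite lfunE.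
    by rewrite mem_mulmx_lker; apply/eqP/expand_annihilator; rewrite -mulmxA.
  rewrite lfunE; split; first by apply/mem_columns; exists a.
  apply/eqP; rewrite mulmxA; apply/expand_annihilator/eqP.
  by rewrite -mem_mulmx_lker.
apply: limg_dim_eq; apply/eqP; rewrite -subv0; apply/subvP => a.
rewrite memv_cap memv_ker lfunE memv0 => /andP[_ /eqP aG].
by apply/eqP/Gf.
Qed.

(** The section by H_x consists of the points Ga with xGa = 0, so inclusion of sections is the
    implication in [rank_support_subP]. *)
Lemma section_subP G x x' :
  (<<columns G>> :&: restrv (mulmx_lker x) <=
   <<columns G>> :&: restrv (mulmx_lker x'))%VS <->
  (rank_support (x' *m G) <= rank_support (x *m G))%VS.
Proof.
rewrite rank_support_subP; split=> [/subvP sub a|sub].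
  rewrite -!mulmxA => xa; apply/eqP; rewrite -mem_mulmx_lker -mem_restrv.
  have /sub : columns_comb G a \in (<<columns G>> :&: restrv (mulmx_lker x))%VS.
    rewrite memv_cap mem_restrv mem_mulmx_lker xa eqxx andbT.
    by apply/mem_columns; exists a.
  by rewrite memv_cap => /andP[].
apply/subvP => u; rewrite !memv_cap !mem_restrv !mem_mulmx_lker.
move=> /andP[uG /eqP xu]; rewrite uG /=; move/mem_columns: uG xu => [a ->] xu.
by apply/eqP; rewrite mulmxA; apply: sub; rewrite -mulmxA.
Qed.

Lemma hyperplane_mulmx_lker x : x != 0 -> hyperplane (mulmx_lker x).
Proof.
by move=> x0; rewrite /hyperplane -[RHS](dim_mulmx_lker x) rank_rV x0 addn1.
Qed.

(** Being proper, [H] lies in some H_x, and the two have equal dimension. *)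
Lemma hyperplaneP (H : {vspace 'cV[L]_k}) :
  hyperplane H <-> exists2 x : 'rV_k, x != 0 & H = mulmx_lker x.
Proof.
split=> [Hh|[x x0 ->]]; last exact: hyperplane_mulmx_lker.
have [|x x0 xH] := @proper_subspace_annihilator _ _ H.
  apply/eqP => HT; move: Hh; rewrite /hyperplane HT dimvf /dim /= muln1.
  by move/eqP; rewrite eqn_leq ltnn.
exists x => //; apply/eqP; rewrite eqEdim -ltnS.
rewrite (hyperplane_mulmx_lker x0) Hh leqnn andbT.
by apply/subvP => u /xH xu; rewrite mem_mulmx_lker xu.
Qed.

(** Inclusion of kernels puts x' in the row space of x. Conversely, x' being nonzero forces a
    nonzero factor, which preserves the kernel. *)
Lemma eq_mulmx_lker x x' : x' != 0 ->
  mulmx_lker x = mulmx_lker x' <-> exists alpha : L, x' = alpha *: x.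
Proof.
move=> x'0; split=> [xx'|[c x'E]].
  apply/sub_rVP/submx_annihilatorP => u /eqP xu; apply/eqP.
  by rewrite -mem_mulmx_lker -xx' mem_mulmx_lker.
have c0 : c != 0 by apply: contra x'0 => /eqP c0; rewrite x'E c0 scale0r.
apply/vspaceP => u; rewrite !mem_mulmx_lker x'E -scalemxAl scaler_eq0.
by rewrite (negbTE c0).
Qed.

(** A vector a of F^n with Ga = 0 is orthogonal to the support of every xG, so a nonzero one exists
    exactly when the supports span a proper subspace. *)
Lemma nondegenerate_rows G : nondegenerate_code <<rows G>>%VS <-> col_free G.
Proof.
rewrite /nondegenerate_code; set W := (\sum_(v | _) _)%VS.
have sW v : v \in <<rows G>>%VS -> (rank_support v <= W)%VS.
  by move=> vG; apply: (@sumv_sup _ _ _ (v : finvect_type (restr 'rV[L]_n))).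
split=> [WT a Ga|Gf].
  have aW w : w \in W -> a^T *m w = 0.
    move=> /memv_sumP[f fP ->]; rewrite mulmx_sumr big1 // => v vG.
    have /mem_rows[x vE] := vG.
    apply: ((rank_support_orthogonal _ _).2 _ _ (fP _ vG)).
    by rewrite trmxK vE -mulmxA Ga mulmx0.
  apply/trmx_inj; rewrite trmx0; apply/rowP => i.
  have /matrixP/(_ 0 0) : a^T *m delta_mx i 0 = 0 :> 'M_1.
    by apply: aW; rewrite [W]WT memvf.
  by rewrite -colE !mxE.
apply/eqP; apply/negPn/negP => /proper_subspace_annihilator[y y0 yW].
case/eqP: y0; apply/trmx_inj; rewrite trmx0; apply: Gf.
(* Each row of [G] is a codeword, so [y] annihilates its support. *)
apply/row_matrixP => i; rewrite row_mul row0.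
apply/rank_support_orthogonal => w wv; apply: yW; apply: (subvP (sW _ _) _ wv).
by apply/mem_rows; exists (delta_mx 0 i); rewrite rowE.
Qed.

(** Dually, a row x with xG = 0 is an L-linear functional vanishing on the columns, hence on their
    L-span. *)
Lemma Lspan_columns G : Lspan <<columns G>>%VS = fullv <-> row_free G.
Proof.
have sL u : u \in <<columns G>>%VS -> (u : 'cV[L]_k) \in Lspan <<columns G>>%VS.
  move=> uG; apply: memv_span; apply/fintype.imageP.
  by exists (u : finvect_type (restr 'cV[L]_k)).
rewrite row_free_kerP; split=> [LT x xG|Gf].
  have xL u : u \in Lspan <<columns G>>%VS -> x *m u = 0.
    move=> uL; apply/eqP; rewrite -mem_mulmx_lker; apply: subvP uL.
    apply/span_subvP => _ /fintype.imageP[w /mem_columns[a wE] ->].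
    by rewrite mem_mulmx_lker wE mulmxA xG mul0mx.
  apply/rowP => i; have /matrixP/(_ 0 0) : x *m delta_mx i 0 = 0 :> 'M_1.
    by apply: xL; rewrite LT memvf.
  by rewrite -colE !mxE.
apply/eqP; apply/negPn/negP => /proper_subspace_annihilator[x x0 xL].
case/eqP: x0; apply: Gf; apply/rowP => j; rewrite mxE.
have /xL/matrixP/(_ 0 0) : col j G \in Lspan <<columns G>>%VS.
  apply: sL; apply/mem_columns; exists (delta_mx j 0).
  by rewrite /columns_comb map_delta_mx -colE.
by rewrite colE mulmxA -colE !mxE.
Qed.

(* By [nondegenerate_rows] and [Lspan_columns], these are exactly the generator
   matrices of nondegenerate codes, and the bases of systems. *)
Definition good G : Prop := row_free G /\ col_free G.

(** By [dim_section], the largest dimension of a hyperplane section and the least rank of a nonzero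
    codeword add up to n. *)
Lemma is_code_system G d : good G ->
  is_code k d <<rows G>>%VS <-> is_system n d <<columns G>>%VS.
Proof.
move=> [Gr Gc]; have dimU x := dim_section x Gc.
have /eqP dr : \dim <<rows G>> == k.
  by have /free_rows := Gr; rewrite /free size_image card_ord.
have /eqP dc : \dim <<columns G>> == n.
  by have /free_columns := Gc; rewrite /free size_image card_ord.
have xG0 x : (x *m G != 0) = (x != 0).
  apply/idP/idP; first by apply: contra => /eqP ->; rewrite mul0mx.
  by apply: contra => /eqP; move/row_free_kerP: Gr => /[apply] ->.
split=> [[_ [v [/mem_rows[x ->]]]]|[_ _ [t [[H /hyperplaneP[x x0 ->]] Ht tmax] ->]]].
  rewrite xG0 => x0 <- dmin; split=> //; first exact/Lspan_columns.
  exists (\dim (<<columns G>> :&: restrv (mulmx_lker x))%VS); last first.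
    by rewrite -[X in (X - _)%N](dimU x) addKn.
  split; first by exists (mulmx_lker x) => //; apply: hyperplane_mulmx_lker.
  (* With [rk (x *m G)] added, the right side is n, rewritten as the same sum for [y]; what remains
     is [rk (x *m G) <= rk (y *m G)]. *)
  move=> _ /hyperplaneP[y y0 ->]; rewrite -(leq_add2r (rk (x *m G))).
  rewrite (dimU x) -[leqRHS](dimU y) leq_add2l dmin ?xG0 //.
  by apply/mem_rows; exists y.
have dE : (n - t)%N = rk (x *m G) by rewrite -[in LHS](dimU x) Ht addKn.
split=> //.
  exists (x *m G); rewrite xG0 x0 dE; split=> //.
  by apply/mem_rows; exists x.
move=> _ /mem_rows[y ->]; rewrite xG0 => y0.
rewrite -[X in (X - _)%N](dimU y) leq_subLR leq_add2r tmax //.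
exact: hyperplane_mulmx_lker.
Qed.

Lemma minimal_cutting G : row_free G ->
  minimal_code <<rows G>>%VS <-> cutting <<columns G>>%VS.
Proof.
move=> /[dup] /row_free_inj Ginj Gr; split=> [Gmin|Gcut].
  move=> _ _ /hyperplaneP[x x0 ->] /hyperplaneP[x' x'0 ->] /section_subP sub.
  have [||c] := Gmin _ _ _ _ sub; first by apply/mem_rows; exists x.
    by apply/mem_rows; exists x'.
  rewrite scalemxAl => /Ginj x'E.
  by apply/eq_mulmx_lker => //; exists c.
move=> _ _ /mem_rows[x ->] /mem_rows[x' ->] sub.
(* The kernel of the zero row is the whole space and not a hyperplane, so zero codewords are handled
   apart from the cutting property. *)
have [->|x'0] := eqVneq x' 0; first by exists 0; rewrite mul0mx scale0r.
have [x0|x0] := eqVneq x 0; last first.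
  have /eq_mulmx_lker[//|c ->] : mulmx_lker x = mulmx_lker x'.
    apply: Gcut; [exact: hyperplane_mulmx_lker..|exact/section_subP].
  by exists c; rewrite scalemxAl.
(* The zero word is annihilated by every unit vector, hence so is x'G; thus x'G = 0 and x' = 0. *)
case/eqP: x'0; apply: (row_free_kerP G).1 => //; apply/rowP => j.
have /rank_support_subP/(_ (delta_mx j 0)) := sub.
rewrite x0 !mul0mx => /(_ erefl)/matrixP/(_ 0 0).
by rewrite map_delta_mx -colE !mxE.
Qed.

End GeneratorMatrix.

(** * Equivalence of matrices, codes and systems *)

Section MatrixEquivalence.
Variables (F : finFieldType) (L : fieldExtType F) (n k : nat).
Implicit Types (G : 'M[L]_(k, n)).
Local Notation inL := (map_mx (in_alg L)).

(** For codes, [B] changes the generator matrix and [A] is the equivalence; for systems, [B] is the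
    automorphism and [A] changes the F-basis. *)
Definition mx_equiv G G' : Prop :=
  exists B A, [/\ B \in unitmx, A \in unitmx & G' = B *m G *m inL A].

Lemma mx_equiv_refl G : mx_equiv G G.
Proof.
by exists 1%:M, 1%:M; rewrite !unitmx1 map_mx1 mulmx1 mul1mx.
Qed.

Lemma code_equiv_generator C C' G G' : generator_matrix C G ->
  generator_matrix C' G' -> code_equiv C C' -> mx_equiv G G'.
Proof.
move=> /andP[/eqP <- _] /andP[/eqP GC' fG'] [A Au C'E].
have /submxP[B G'E] : (G' <= G *m inL A)%MS.
  apply/row_subP => i.
  have : row i G' \in C'.
    by rewrite -GC'; apply/mem_rows; exists (delta_mx 0 i); rewrite rowE.
  rewrite C'E => /memv_imgP[_ /mem_rows[x ->] ->].
  by rewrite lfunE /= -mulmxA submxMl.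
exists B, A; split=> //; last by rewrite -mulmxA.
(* A row killed by [B] is killed by [G'], whose rows are independent. *)
rewrite -row_free_unit; apply/row_free_kerP => x xB.
apply: (row_free_kerP G').1; first exact/free_rows.
by rewrite G'E mulmxA xB mul0mx.
Qed.

Lemma endo_mulmx (f : 'End('cV[L]_k)) : exists B : 'M_k, forall u, f u = B *m u.
Proof.
exists (\matrix_(i, j) f (delta_mx j 0) i 0) => u.
rewrite {1}(matrix_sum_delta u) linear_sum /=; apply/colP => i.
rewrite summxE mxE; apply: eq_bigr => j _.
by rewrite big_ord1 linearZ /= !mxE mulrC.
Qed.

Lemma system_equiv_generator U U' G G' : basis_of U (columns G) ->
  basis_of U' (columns G') -> system_equiv U U' -> mx_equiv G G'.
Proof.
move=> /andP[/eqP <- _] /andP[/eqP GU' fG'] [f fbij fU].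
have [B fB] := endo_mulmx f.
have /fin_all_exists[a aE] j : exists a : 'cV[F]_n, col j G' = B *m (G *m inL a).
  have : [set` U'] (col j G' : restr 'cV[L]_k).
    rewrite /= -GU'; apply/mem_columns; exists (delta_mx j 0).
    by rewrite /columns_comb map_delta_mx -colE.
  by rewrite -fU => -[_ /mem_columns[a ->] <-]; exists a; rewrite fB.
(* Column j of [A] holds the coordinates, in the columns of [G], of the preimage under [f] of column
   j of [G']. *)
pose A := \matrix_(i, j) a j i 0.
have G'E : G' = B *m G *m inL A.
  apply/trmx_inj/row_matrixP => j; rewrite -!tr_col aE; congr trmx.
  rewrite [RHS]colE -!mulmxA -(map_delta_mx (in_alg L)) -map_mxM -colE.
  by congr (_ *m (_ *m inL _)); apply/colP=> i; rewrite !mxE.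
exists B, A; split=> //.
  apply/unitmx_kerP => u; rewrite -fB => fu; apply: (bij_inj fbij).
  by rewrite fu linear0.
(* A vector killed by [A] is an F-linear relation between the columns of [G']. *)
apply/unitmx_kerP => b Ab; apply: (free_columns G').1 => //.
by rewrite G'E -!mulmxA -map_mxM Ab map_mx0 !mulmx0.
Qed.

Lemma mx_equiv_code G G' :
  mx_equiv G G' -> code_equiv <<rows G>>%VS <<rows G'>>%VS.
Proof.
move=> [B [A [Bu Au ->]]]; exists A => //; apply/vspaceP => v.
apply/idP/memv_imgP => [/mem_rows[x ->]|[_ /mem_rows[x ->] ->]].
  exists (x *m B *m G); last by rewrite lfunE /= !mulmxA.
  by apply/mem_rows; exists (x *m B).
apply/mem_rows; exists (x *m invmx B).
by rewrite lfunE /= !mulmxA mulmxKV.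
Qed.

Lemma mx_equiv_system G G' :
  mx_equiv G G' -> system_equiv <<columns G>>%VS <<columns G'>>%VS.
Proof.
move=> [B [A [Bu Au ->]]]; exists (linfun (mulmx B)).
  by exists (mulmx (invmx B)) => u; rewrite lfunE /= ?mulKmx ?mulKVmx.
apply/seteqP; split=> [_ [_ /mem_columns[a ->] <-]|_ /mem_columns[a ->]] /=.
  apply/mem_columns; exists (invmx A *m a).
  by rewrite lfunE /= /columns_comb -!mulmxA -map_mxM mulKVmx.
exists (columns_comb G (A *m a)); first by apply/mem_columns; exists (A *m a).
by rewrite lfunE /= /columns_comb -!mulmxA -map_mxM.
Qed.

Lemma code_equiv_trans (C1 C2 C3 : {vspace 'rV[L]_n}) :
  code_equiv C1 C2 -> code_equiv C2 C3 -> code_equiv C1 C3.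
Proof.
move=> [A Au ->] [B Bu ->]; exists (A *m B); first by rewrite unitmx_mul Au.
rewrite -limg_comp; congr (_ @: _)%VS; apply/lfunP => v.
by rewrite comp_lfunE !lfunE /= map_mxM mulmxA.
Qed.

Lemma system_equiv_trans (U1 U2 U3 : {vspace restr 'cV[L]_k}) :
  system_equiv U1 U2 -> system_equiv U2 U3 -> system_equiv U1 U3.
Proof.
move=> [f fb fU] [g gb gU]; exists (g \o f)%VF.
  by apply: (eq_bij (bij_comp gb fb)) => u; rewrite comp_lfunE.
rewrite -gU -fU image_comp; apply: eq_imagel => u _ /=.
by rewrite comp_lfunE.
Qed.

(** * Matrix representatives, and the two maps on classes *)

Lemma exists_generator_matrix (C : {vspace 'rV[L]_n}) :
  \dim C = k -> exists G, generator_matrix C G.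
Proof.
move=> Ck; move: (vbasis C) (vbasisP C); rewrite Ck => b bC.
exists (\matrix_i tnth b i); rewrite /generator_matrix.
suff -> : rows (\matrix_i tnth b i) = b by [].
rewrite -[RHS]map_tnth_enum; apply: eq_map => i; exact: rowK.
Qed.

Lemma exists_basis_columns (U : {vspace restr 'cV[L]_k}) :
  \dim U = n -> exists G, basis_of U (columns G).
Proof.
move=> Un; move: (vbasis U) (vbasisP U); rewrite Un => b bU.
exists (\matrix_(i, j) (tnth b j : 'cV[L]_k) i 0).
suff -> : columns (\matrix_(i, j) (tnth b j : 'cV[L]_k) i 0) = b by [].
rewrite -[RHS]map_tnth_enum; apply: eq_map => j.
by apply/colP => i; rewrite !mxE.
Qed.

Lemma good_generator_matrix G : good G -> generator_matrix <<rows G>>%VS G.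
Proof. by case=> /free_rows fG _; rewrite /generator_matrix /basis_of eqxx. Qed.

Lemma good_basis_columns G : good G -> basis_of <<columns G>>%VS (columns G).
Proof. by case=> _ /free_columns fG; rewrite /basis_of eqxx. Qed.

(** Any representative with any generator matrix yields a matrix equivalent to [G], so the union in
    [Phi] collapses to one class, which [G] itself attains. *)
Lemma Phi_code_class G : good G ->
  Phi L n k (code_class <<rows G>>%VS) = system_class <<columns G>>%VS.
Proof.
move=> Gg; apply/seteqP; split=> [U [C [G' [CG' GG' U'U]]]|U GU].
  apply: system_equiv_trans U'U; apply: mx_equiv_system.
  exact: code_equiv_generator (good_generator_matrix Gg) GG' CG'.
exists <<rows G>>%VS, G; split=> //; last exact: good_generator_matrix.
exact/mx_equiv_code/mx_equiv_refl.
Qed.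

Lemma Psi_system_class G : good G ->
  Psi L n k (system_class <<columns G>>%VS) = code_class <<rows G>>%VS.
Proof.
move=> Gg; apply/seteqP; split=> [C [U [G' [UG' GG' C'C]]]|C GC].
  apply: code_equiv_trans C'C; apply: mx_equiv_code.
  exact: system_equiv_generator (good_basis_columns Gg) GG' UG'.
exists <<columns G>>%VS, G; split=> //; last exact: good_basis_columns.
exact/mx_equiv_system/mx_equiv_refl.
Qed.

(** Indexing codes and systems by the same good matrices turns [Phi] and [Psi] into the exchange of
    row span and column span. *)
Definition code_classes_of (P : set 'M[L]_(k, n)) : set (set {vspace 'rV[L]_n}) :=
  [set code_class <<rows G>>%VS | G in [set G | good G /\ P G]].

Definition system_classes_of (P : set 'M[L]_(k, n)) :
    set (set {vspace restr 'cV[L]_k}) :=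
  [set system_class <<columns G>>%VS | G in [set G | good G /\ P G]].

Lemma Phi_Psi_inverse P :
  inverse_bijections (code_classes_of P) (system_classes_of P)
    (Phi L n k) (Psi L n k).
Proof.
have PhiK : {in code_classes_of P, cancel (Phi L n k) (Psi L n k)}.
  by move=> _ /set_mem[G [Gg _] <-]; rewrite Phi_code_class // Psi_system_class.
have PsiK : {in system_classes_of P, cancel (Psi L n k) (Phi L n k)}.
  by move=> _ /set_mem[G [Gg _] <-]; rewrite Psi_system_class // Phi_code_class.
have PhiP G : good G /\ P G ->
    system_classes_of P (Phi L n k (code_class <<rows G>>%VS)).
  by move=> GP; exists G => //; rewrite Phi_code_class //; case: GP.
have PsiP G : good G /\ P G ->
    code_classes_of P (Psi L n k (system_class <<columns G>>%VS)).
  by move=> GP; exists G => //; rewrite Psi_system_class //; case: GP.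
split=> //; split; [|exact: (can_in_inj PhiK)| | |exact: (can_in_inj PsiK)|].
- by move=> _ [G GP <-]; apply: PhiP.
- move=> _ [G [Gg GP] <-]; exists (code_class <<rows G>>%VS); first by exists G.
  exact: Phi_code_class.
- by move=> _ [G GP <-]; apply: PsiP.
- move=> _ [G [Gg GP] <-]; exists (system_class <<columns G>>%VS); first by exists G.
  exact: Psi_system_class.
Qed.

(** A code of dimension k has a generator matrix, and nondegeneracy makes it [col_free]: arbitrary
    codes give way to good matrices. *)
Lemma code_classesE d (Q : set {vspace 'rV[L]_n}) :
  [set code_class C |
     C in [set C | [/\ is_code k d C, nondegenerate_code C & Q C]]] =
  code_classes_of [set G | is_code k d <<rows G>>%VS /\ Q <<rows G>>%VS].
Proof.
apply/seteqP; split=> [_ [C [[Ck Cd Cm] Cn QC] <-]|_ [G [Gg [GP GQ]] <-]].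
  have [G /andP[/eqP GC Gf]] := exists_generator_matrix Ck.
  rewrite -GC in Ck Cd Cm Cn QC *; exists G => //; split=> //; split.
    exact/free_rows.
  exact/nondegenerate_rows.
exists <<rows G>>%VS => //; split=> //.
by apply/nondegenerate_rows; case: Gg.
Qed.

Lemma system_classesE d (Q : set {vspace restr 'cV[L]_k}) :
  [set system_class U | U in [set U | is_system n d U /\ Q U]] =
  system_classes_of [set G | is_system n d <<columns G>>%VS /\ Q <<columns G>>%VS].
Proof.
apply/seteqP; split=> [_ [U [[Un UL Ud] QU] <-]|_ [G [Gg GP] <-]]; last first.
  by exists <<columns G>>%VS.
have [G /andP[/eqP GU Gf]] := exists_basis_columns Un.
rewrite -GU in Un UL Ud QU *; exists G => //; split=> //; split.
  exact/Lspan_columns.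
exact/free_columns.
Qed.

(** Serves both halves of the theorem, with trivial properties for the full correspondence, and
    minimality and cutting for the restricted one. *)
Lemma Phi_Psi_inverse_restricted d (Q : set {vspace 'rV[L]_n})
    (Q' : set {vspace restr 'cV[L]_k}) :
  (forall G, good G -> Q <<rows G>>%VS <-> Q' <<columns G>>%VS) ->
  inverse_bijections
    [set code_class C |
       C in [set C | [/\ is_code k d C, nondegenerate_code C & Q C]]]
    [set system_class U | U in [set U | is_system n d U /\ Q' U]]
    (Phi L n k) (Psi L n k).
Proof.
move=> QQ'; rewrite code_classesE system_classesE.
set P := [set G | _]; set P' := [set G | _].
suff -> : system_classes_of P' = system_classes_of P by apply: Phi_Psi_inverse.
congr (_ @` _); apply/seteqP; split=> G [Gg [GP GQ]]; split=> //; split.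
- exact/is_code_system.
- exact/QQ'.
- exact/is_code_system.
- exact/QQ'.
Qed.

End MatrixEquivalence.

Theorem corollary5p7 (F : finFieldType) (L : fieldExtType F) (n k d : nat)
    (hn : (0 < n)%N) (hk : (0 < k)%N) (hd : (0 < d)%N) :
  inverse_bijections (nondeg_classes L n k d) (system_classes L n k d)
    (Phi L n k) (Psi L n k) /\
  inverse_bijections (nondeg_minimal_classes L n k d) (cutting_classes L n k d)
    (Phi L n k) (Psi L n k).
Proof.
split; last first.
  by apply: Phi_Psi_inverse_restricted => G [Gr _]; apply: minimal_cutting.
(* With trivial properties, only the trivial conjuncts remain to be removed. *)
have := @Phi_Psi_inverse_restricted F L n k d setT setT (fun _ _ => iff_refl _).
congr inverse_bijections; congr (_ @` _); apply/seteqP.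
  by split=> [C []|C []].
by split=> [U []|U].
Qed.
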